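(* For every odd integer $k>1$, the cycle $C_{2k}$ admits a $2$-graceful labeling.
   Context: $C_n$ denotes the cycle on $n$ vertices (with $n$ edges). For a graph $\Gamma$ of size $e$ and a divisor $d$ of $e$ with $e=d\cdot m$, a $d$-graceful labeling of $\Gamma$ is an injective function $f:V(\Gamma)\to\{0,1,\ldots,d(m+1)-1\}$ such that $\{|f(x)-f(y)| : [x,y]\in E(\Gamma)\}=\{1,2,\ldots,d(m+1)-1\}\setminus\{m+1,2(m+1),\ldots,(d-1)(m+1)\}$. (For $C_{2k}$ with $d=2$: $m=k$ and the labels lie in $\{0,\ldots,2k+1\}$ with edge differences exactly $\{1,\ldots,2k+1\}\setminus\{k+1\}$.) *)

(* Defs.v *)
From mathcomp Require Import all_boot all_order all_algebra.

Set Implicit Arguments.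
Unset Strict Implicit.
Unset Printing Implicit Defensive.

Record sgraph := SGraph {
  vertex :> finType;
  adj : rel vertex;
  adj_sym : symmetric adj;
  adj_irrefl : irreflexive adj }.

Definition edges (G : sgraph) : {set {set G}} :=
  [set [set p.1; p.2] | p : G * G & adj p.1 p.2].

Definition gsize (G : sgraph) : nat := #|edges G|.

(* [ordS x] is [x + 1] modulo [n].  This is the cycle with [n] edges only for
   [n >= 3] (see [gsize_cycle]); the guard [x != y] removes the loop at [n = 1]. *)
Definition cycle_adj (n : nat) : rel 'I_n :=
  [rel x y | (x != y) && ((y == ordS x) || (x == ordS y))].

Lemma cycle_adj_sym n : symmetric (@cycle_adj n).
Proof. by move=> x y; rewrite /cycle_adj /= eq_sym orbC. Qed.

Lemma cycle_adj_irrefl n : irreflexive (@cycle_adj n).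
Proof. by move=> x; rewrite /cycle_adj /= eqxx. Qed.

Definition cycle_graph (n : nat) : sgraph :=
  SGraph (@cycle_adj_sym n) (@cycle_adj_irrefl n).

(* [`|a - b|] is the absolute difference of the natural numbers [a] and [b],
   not a truncated subtraction. *)
Definition graceful_labeling (d : nat) (G : sgraph) (f : G -> nat) : Prop :=
  let m := gsize G %/ d in
  [/\ d %| gsize G,
      injective f,
      forall x, f x <= d * (m + 1) - 1
    & forall D : nat,
        (exists x y, adj x y /\ `|f x - f y|%N = D) <->
        (1 <= D <= d * (m + 1) - 1) /\
        ~ (exists2 i, 1 <= i <= d - 1 & D = i * (m + 1))].

Lemma ordS_neq n (x : 'I_n) : 2 <= n -> ordS x != x.
Proof.
move=> n2; apply/eqP => /(congr1 val) /=.
have := ltn_ord x; rewrite leq_eqVlt => /orP[/eqP e|lt].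
  by rewrite e modnn => e0; rewrite -e -e0 in n2.
by rewrite modn_small // => /eqP; rewrite eqn_leq ltnn.
Qed.

Lemma ordS2_neq n (x : 'I_n) : 3 <= n -> ordS (ordS x) != x.
Proof.
move=> n3; apply/eqP => /(congr1 val) /=.
rewrite -[(_ %% _).+1]addn1 modnDml addn1 => e.
have : x + 2 == x + 0 %[mod n] by rewrite addn0 addn2 e modn_small.
by rewrite eqn_modDl mod0n modn_small.
Qed.

Lemma gsize_cycle n : 3 <= n -> gsize (cycle_graph n) = n.
Proof.
move=> n3; rewrite -[RHS]card_ord /gsize.
have -> : edges (cycle_graph n) = [set [set x; ordS x] | x : 'I_n].
  apply/setP => A; apply/imsetP/imsetP => [[[x y]]|[x _ ->]].
    rewrite !inE /= /cycle_adj /= => /andP[_ /orP[]] /eqP -> ->; first by exists x.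
    by exists y => //; rewrite setUC.
  exists (x, ordS x) => //.
  by rewrite !inE /= /cycle_adj /= eqxx /= andbT eq_sym (ordS_neq _ (ltnW n3)).
apply: card_imset => x y /setP e.
have := e x; have := e (ordS x); rewrite !inE !eqxx orbT /=.
move=> /esym/orP[/eqP h1|/eqP h1 _]; last exact: ordS_inj h1.
move=> /esym/orP[/eqP //|/eqP h2].
by case/eqP: (ordS2_neq y n3); rewrite -h2.
Qed.

(* Main.v *)
(** Write [k = 2t + 1]. Label the cycle by the zigzag
    [0, 2k+1, 1, 2k, 2, ...], whose consecutive differences decrease by one.
    At position [2t] the even-indexed labels skip [t] and the label [t] is
    inserted at position [2t + 1], between [t + 1] and [t + 2]; then the zigzag
    resumes. The differences are [2k+1, ..., k+4] on the first part,
    [k+2, 1, 2] around the insertion, [k, ..., 3] on the last part, and [k+3]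
    on the closing edge, so that only [k+1] is missing. *)
Require Import Defs.
From mathcomp Require Import all_boot all_order all_algebra.
From mathcomp Require Import zify.

Definition zigzag (t j : nat) : nat :=
  if odd j then
    if j./2 < t then 4 * t + 3 - j./2
    else if j./2 == t then t else 4 * t + 4 - j./2
  else if j./2 < t then j./2 else j./2.+1.

Definition zigzag_gap (t j : nat) : nat :=
  if j == 4 * t + 1 then 2 * t + 4
  else if j == 2 * t - 1 then 2 * t + 3
  else if j == 2 * t then 1
  else if j == 2 * t + 1 then 2
  else 4 * t + 3 - j.

(** Even positions take the labels [0..2t+1] except [t]; odd ones take [t] and [2t+4..4t+3]. *)
Lemma zigzag_inj t i j :
  i < 4 * t + 2 -> j < 4 * t + 2 -> zigzag t i = zigzag t j -> i = j.
Proof. by rewrite /zigzag; do ![case: ifP]; lia. Qed.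

Lemma zigzag_le t j : j < 4 * t + 2 -> zigzag t j <= 4 * t + 3.
Proof. by rewrite /zigzag; do ![case: ifP]; lia. Qed.

Lemma zigzag_succ t j : 0 < t -> j < 4 * t + 1 ->
  `|zigzag t j - zigzag t j.+1|%N = zigzag_gap t j.
Proof. by rewrite /zigzag /zigzag_gap; do ![case: ifP]; lia. Qed.

Lemma zigzag_close t : 0 < t ->
  `|zigzag t (4 * t + 1) - zigzag t 0|%N = zigzag_gap t (4 * t + 1).
Proof. by rewrite /zigzag /zigzag_gap; do ![case: ifP]; lia. Qed.

Lemma zigzag_gap_range t j : 0 < t -> j < 4 * t + 2 ->
  (1 <= zigzag_gap t j <= 4 * t + 3) && (zigzag_gap t j != 2 * t + 2).
Proof. rewrite /zigzag_gap; do ![case: ifP]; lia. Qed.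

(** The rule [4t+3-j] alone yields [2..4t+3]. Its values [2, 2t+4, 2t+3, 2t+2] at the exceptional
    positions become [2t+4, 2t+3, 1, 2], which only trades [2t+2] for [1]. *)
Lemma zigzag_gap_surj t D : 0 < t -> 1 <= D <= 4 * t + 3 -> D != 2 * t + 2 ->
  exists2 j, j < 4 * t + 2 & zigzag_gap t j = D.
Proof.
move=> t0 D1 D2.
exists (if D == 2 * t + 4 then 4 * t + 1 else if D == 2 * t + 3 then 2 * t - 1
        else if D == 1 then 2 * t else if D == 2 then 2 * t + 1
        else 4 * t + 3 - D); rewrite /zigzag_gap; do ![case: ifP]; lia.
Qed.

Lemma zigzag_ordS t n (x : 'I_n) : 0 < t -> n = 4 * t + 2 ->
  `|zigzag t x - zigzag t (ordS x)|%N = zigzag_gap t x.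
Proof.
move=> t0 nE /=; have xn := ltn_ord x.
have [xl|xl] := ltnP x.+1 n.
  by rewrite modn_small // zigzag_succ //; lia.
(* At the last vertex [ordS] wraps to [0]: the closing edge. *)
have -> : nat_of_ord x = 4 * t + 1 by lia.
have -> : (4 * t + 1).+1 = n by lia.
by rewrite modnn zigzag_close.
Qed.

Theorem theorem4p4 (k : nat) (k_odd : odd k) (k_gt1 : 1 < k) :
  exists f : cycle_graph (2 * k) -> nat, graceful_labeling 2 f.
Proof.
pose t := k./2.
have t0 : 0 < t by lia.
have nE : 2 * k = 4 * t + 2 by lia.
exists (fun x : 'I_(2 * k) => zigzag t x).
rewrite /graceful_labeling gsize_cycle; last by lia.
rewrite mulKn //.
have maxE : 2 * (k + 1) - 1 = 4 * t + 3 by lia.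
rewrite maxE; split=> [||x|D].
- exact: dvdn_mulr.
- move=> x y /zigzag_inj xy; apply: val_inj.
  by apply: xy; rewrite -nE ltn_ord.
- by apply: zigzag_le; rewrite -nE ltn_ord.
split=> [[x [y [/andP[_ xy] <-]]]|[D_range D_neq]].
  (* The gap is indexed by whichever endpoint precedes the other. *)
  have [j ->] : exists j : 'I_(2 * k),
      `|zigzag t x - zigzag t y|%N = zigzag_gap t j.
    case/orP: xy => /eqP ->; first by exists x; rewrite zigzag_ordS.
    by exists y; rewrite distnC zigzag_ordS.
  have jn : j < 4 * t + 2 by rewrite -nE ltn_ord.
  have /andP[g_range g_neq] := zigzag_gap_range _ _ t0 jn.
  (* Here [i = 1], so the excluded value is [k + 1 = 2t + 2]. *)
  by split=> // -[i i1 gE]; move: g_neq; rewrite gE; nia.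
have [||j jn <-] := zigzag_gap_surj t D t0 => //.
  by apply/eqP => DE; apply: D_neq; exists 1; lia.
have j2k : j < 2 * k by rewrite nE.
exists (Ordinal j2k), (ordS (Ordinal j2k)); split.
  by rewrite /= /cycle_adj /= eqxx andbT eq_sym ordS_neq //; lia.
by rewrite zigzag_ordS.
Qed.
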